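(* There does not exist a Seidel matrix $S$ with characteristic polynomial $\chi_S(x)=(x+5)^{33}(x-9)^{12}(x-11)^4(x-13)$.
   Context: A Seidel matrix is a symmetric matrix with all diagonal entries $0$ and all off-diagonal entries $\pm1$. For a square matrix $M$, $\chi_M(x)=\det(xI-M)$. *)

(* Defs.v *)
From mathcomp Require Import all_boot all_order all_algebra.

Set Implicit Arguments.
Unset Strict Implicit.
Unset Printing Implicit Defensive.

Import GRing.Theory.
Local Open Scope ring_scope.

Definition is_seidel (n : nat) (S : 'M[int]_n) : Prop :=
  [/\ S^T = S,
      forall i, S i i = 0
    & forall i j, i != j -> S i j = 1 \/ S i j = -1].

(* Main.v *)
(* Let N = (S + 5)(S - 9). The spectrum {-5, 9, 11, 13} makes N positive
   semidefinite, and it has constant diagonal 4. Since S has order 50 and entries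
   +-1, the off-diagonal entries satisfy N_ij = r_i + r_j + 2 mod 4, where the row
   sums r_i of S are odd. So r mod 4 splits the indices into at most two classes,
   with N_ij divisible by 4 inside a class and equal to 2 mod 4 across.
   - Two classes: Cauchy-Schwarz for the form N bounds the sum of N_ij^2 below by
     4 * 50^2 = 10000, but tr N^2 = 9280.
   - One class: 4 |N_ij| <= N_ij^2 everywhere, hence
     4 tr(S N) <= tr N^2 - 50 * 16 = 8480, but 4 tr(S N) = 9376. *)

Require Import Defs.
From mathcomp Require Import all_boot all_order all_algebra.
From mathcomp Require Import all_field spectral.
From mathcomp Require Import zify.

Import GRing.Theory.
Local Open Scope ring_scope.
Local Open Scope sesquilinear_scope.
Import Order.TTheory Num.Theory.

(** * Spectral theory of symmetric integer matrices whose eigenvalues are integers *)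

Lemma char_poly_conjmx {R : comUnitRingType} {n} (P D : 'M[R]_n) :
  P \in unitmx -> char_poly (invmx P *m D *m P) = char_poly D.
Proof.
move=> uP; rewrite /char_poly.
have -> : char_poly_mx (invmx P *m D *m P) =
    map_mx polyC (invmx P) *m char_poly_mx D *m map_mx polyC P.
  rewrite /char_poly_mx mulmxBr mulmxBl scalar_mxC -(mulmxA 'X%:M) -!map_mxM.
  by rewrite mulVmx // map_mx1 mulmx1.
rewrite !det_mulmx mulrAC -det_mulmx -map_mxM mulVmx //.
by rewrite map_mx1 det1 mul1r.
Qed.

Section IntegerSpectrum.

Variables (n : nat) (S : 'M[int]_n.+1) (s : seq int).
Hypotheses (S_sym : S^T = S)
  (char_S : char_poly S = \prod_(a <- s) ('X - a%:P)).

Let SC : 'M[algC]_n.+1 := map_mx intr S.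
Let U := spectralmx SC.
Let d := spectral_diag SC.

Lemma spectral_intmx : SC = invmx U *m diag_mx d *m U.
Proof.
apply/orthomx_spectralP/symmetric_normalmx.
  by apply/is_hermitianmxP; rewrite expr0 scale1r map_mx_id // map_trmx S_sym.
by apply/mxOverP => i j; rewrite mxE Rreal_int ?intr_int.
Qed.

(** Both lists are root multisets of the same characteristic polynomial over [algC], and a product
    of monic linear factors determines its roots with multiplicity. *)
Lemma spectral_diag_intmx :
  perm_eq [seq d 0 i | i : 'I_n.+1] [seq a%:~R | a <- s].
Proof.
apply: prod_XsubC_eq.
transitivity (char_poly SC).
  rewrite spectral_intmx char_poly_conjmx ?spectral_unit //.
  rewrite char_poly_trig ?diag_mx_is_trig // big_map enumT.
  by apply: eq_bigr => i _; rewrite mxE eqxx mulr1n.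
rewrite -(map_char_poly (intr : int -> algC)) char_S big_map.
rewrite rmorph_prod /=; apply: eq_bigr => a _.
by rewrite rmorphB /= map_polyX map_polyC.
Qed.

Lemma horner_intmx (q : {poly int}) :
  map_mx intr (horner_mx S q) =
  invmx U *m diag_mx (map_mx (horner (map_poly intr q)) d) *m U :> 'M[algC]_n.+1.
Proof.
rewrite map_horner_mx -/SC spectral_intmx.
by rewrite horner_mx_uconjC ?spectral_unit // horner_mx_diag.
Qed.

Lemma mxtrace_horner_intmx (q : {poly int}) :
  \tr (horner_mx S q) = \sum_(a <- s) q.[a].
Proof.
apply: (@intr_inj algC); rewrite -[LHS](trace_map_mx intr) horner_intmx.
rewrite mxtrace_mulC mulmxA mulmxV ?spectral_unit // mul1mx mxtrace_diag.
transitivity (\sum_(x <- [seq d 0 i | i : 'I_n.+1]) (map_poly intr q).[x]).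
  by rewrite big_map enumT; apply: eq_bigr => i _; rewrite mxE.
rewrite (perm_big _ spectral_diag_intmx) big_map rmorph_sum /=.
by apply: eq_bigr => a _; rewrite horner_map.
Qed.

(** In the unitary eigenbasis, with v = u U*, the form is the sum of q(d_j) |v_j|^2, and every d_j
    is the image of an element of [s]. *)
Lemma horner_intmx_psd (q : {poly int}) (u : 'rV[int]_n.+1) :
  (forall a, a \in s -> 0 <= q.[a]) -> 0 <= (u *m horner_mx S q *m u^T) 0 0.
Proof.
move=> q_ge0; rewrite -(ler0z algC).
have -> : ((u *m horner_mx S q *m u^T) 0 0)%:~R =
    (map_mx intr (u *m horner_mx S q *m u^T)) 0 0 :> algC by rewrite [RHS]mxE.
rewrite !map_mxM horner_intmx invmx_unitary ?spectral_unitarymx //.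
set v := map_mx intr u *m U^t*.
have -> : map_mx intr u *m (U^t* *m diag_mx (map_mx (horner (map_poly intr q)) d) *m U)
    *m map_mx intr u^T = v *m diag_mx (map_mx (horner (map_poly intr q)) d) *m v^t*.
  rewrite /v trmx_mul map_mxM !mulmxA trmxCK; congr (_ *m _).
  by apply/matrixP => i j; rewrite !mxE /= conj_Creal ?Rreal_int ?intr_int.
rewrite mxE sumr_ge0 // => j _; rewrite mul_mx_diag !mxE.
rewrite mulrAC mulr_ge0 ?mul_conjC_ge0 //.
have: d 0 j \in [seq a%:~R | a <- s].
  by rewrite -(perm_mem spectral_diag_intmx) image_f.
by case/mapP => a /q_ge0 qa ->; rewrite horner_map ler0z.
Qed.

End IntegerSpectrum.

(** * Cauchy-Schwarz bound on a single class *)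

Lemma dvd4_normr_le_sqr (x : int) : (4 %| x)%Z -> 4 * `|x| <= x ^+ 2.
Proof. by case/dvdzP => k ->; nia. Qed.

(* With z_j = sg (N_wj) on A, the bound is the positivity of the form N at
   2 z - |A| e_w; the scaling keeps the vector integral. *)
Lemma gram_class_bound {n} (N : 'M[int]_n) (A : {set 'I_n}) (w : 'I_n) :
    N^T = N -> (forall u : 'rV_n, 0 <= (u *m N *m u^T) 0 0) -> N w w = 4 ->
    (forall i, i \in A -> 2 <= `|N w i|) ->
    (forall i j, i \in A -> j \in A -> (4 %| N i j)%Z) ->
  4 * #|A|%:Z ^+ 2 <= \sum_(i in A) \sum_(j in A) N i j ^+ 2.
Proof.
move=> N_sym N_psd Nww NwA N4.
pose z := \row_j (if j \in A then Num.sg (N w j) else 0).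
pose e := delta_mx 0 w : 'rV[int]_n.
pose p := #|A|%:Z; pose W : int := \sum_(i in A) `|N w i|.
pose Z : int := (z *m N *m z^T) 0 0.
have eNz : e *m N *m z^T = W%:M.
  rewrite -rowE; apply/matrixP => i j; rewrite !ord1 !mxE mulr1n.
  rewrite [RHS]big_mkcond; apply: eq_bigr => k _; rewrite !mxE.
  by case: ifP; rewrite ?mulr0 // normrEsg mulrC.
have zNe : z *m N *m e^T = W%:M.
  rewrite -(tr_scalar_mx 1 W) -eNz -[in RHS]N_sym.
  by rewrite !trmx_mul !trmxK mulmxA.
have eNe : e *m N *m e^T = 4%:M.
  by apply/matrixP => i j; rewrite !ord1 trmx_delta -rowE -colE !mxE Nww.
have form_ge0 : 0 <= 4 * Z - 4 * p * W + 4 * p ^+ 2.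
  have := N_psd (2 *: z - p *: e).
  have -> : (2 *: z - p *: e)^T = 2 *: z^T - p *: e^T by rewrite linearB !linearZ.
  rewrite !mulmxBl !mulmxBr -!scalemxAl -!scalemxAr.
  rewrite zNe eNz eNe [z *m N *m z^T]mx11_scalar -/Z !mxE !mulr1n; lia.
have W_ge : 2 * p <= W.
  have -> : 2 * p = \sum_(i in A) 2 by rewrite sumr_const -[RHS]mulr_natr /p -natz.
  exact: ler_sum.
(* The signs are at most 1 in absolute value, so each term of 4 Z is at most 4 |N_ij| <= N_ij^2. *)
have Z_le : 4 * Z <= \sum_(i in A) \sum_(j in A) N i j ^+ 2.
  have -> : Z = \sum_(i in A) \sum_(j in A) Num.sg (N w i) * N i j * Num.sg (N w j).
    rewrite exchange_big [RHS]big_mkcond /Z mxE; apply: eq_bigr => j _.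
    rewrite !mxE; case: ifP => _; last by rewrite mulr0.
    rewrite -mulr_suml; congr (_ * _); rewrite [RHS]big_mkcond; apply: eq_bigr => i _.
    by rewrite mxE; case: ifP; rewrite ?mul0r.
  rewrite mulr_sumr ler_sum // => i iA; rewrite mulr_sumr ler_sum // => j jA.
  move: (N i j) (dvd4_normr_le_sqr _ (N4 i j iA jA)) => x.
  by do 2!case: sgrP => _; lia.
(* Positivity gives 4 Z >= 4 p W - 4 p^2, which is at least 4 p^2 because W >= 2 p. *)
have : 2 * p * p <= W * p by rewrite ler_wpM2r.
rewrite -/p; lia.
Qed.

(** * Congruences for Seidel matrices *)

Lemma seidel_rowsum_odd {n} (S : 'M[int]_n) (i : 'I_n) :
  is_seidel S -> ((\sum_j S i j + n%:Z) %% 2 = 1)%Z.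
Proof.
case=> _ S0 S1.
have : (2 %| \sum_(j | j != i) (S i j - 1))%Z.
  apply: rpred_sum => j ji; rewrite eq_sym in ji.
  by case: (S1 _ _ ji) => ->.
rewrite sumrB sumr_const cardC1 card_ord => sum_even.
rewrite (bigD1 i) //= S0 add0r.
(* The n - 1 off-diagonal entries are counted by a truncated predecessor, so n = 0, where no index
   [i] exists, is split off. *)
case: n S i S0 S1 sum_even => [|n] S i S0 S1 /=; first by case: i.
by rewrite natz; move: (\sum_(_ | _) _) => x; lia.
Qed.

(* For a, b = +-1 one has a * b = a + b - 1 mod 4. *)
Lemma seidel_sqr_mod4 {n} (S : 'M[int]_n) (i j : 'I_n) : is_seidel S -> i != j ->
  (4 %| (S *m S) i j - (\sum_k S i k + \sum_k S j k - 2 * S i j - n%:Z + 2))%Z.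
Proof.
case=> S_sym S0 S1 ij.
(* The terms k = i and k = j of the full sum contribute 1 - S_ij each, hence 2 - 2 S_ij together. In
   the remaining terms both factors are 0 or -2, so each product is 0 or 4. *)
have -> : (S *m S) i j - (\sum_k S i k + \sum_k S j k - 2 * S i j - n%:Z + 2) =
    \sum_(k | (k != i) && (k != j)) (S i k - 1) * (S j k - 1).
  set F := fun k => (S i k - 1) * (S j k - 1).
  have : \sum_k F k = (S *m S) i j - \sum_k S i k - \sum_k S j k + n%:Z.
    have -> : n%:Z = \sum_(k < n) 1 by rewrite sumr_const card_ord natz.
    rewrite mxE -!sumrB -big_split /=; apply: eq_bigr => k _.
    by rewrite /F -[in S k j]S_sym mxE; lia.
  rewrite (bigD1 i) // (bigD1 j) 1?eq_sym //= {1 2}/F !S0 -[in S j i]S_sym mxE.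
  move: (\sum_(_ | _) _) (\sum_k S i k) (\sum_k S j k) => x y z; lia.
apply: rpred_sum => k /andP[ki kj]; rewrite ![k == _]eq_sym in ki kj.
by case: (S1 _ _ ki) => ->; case: (S1 _ _ kj) => ->.
Qed.

(** * Sum of squares over two classes *)

(** With classes of sizes p and q, the diagonal blocks contribute at least 4 p^2 and 4 q^2 by
    [gram_class_bound], taking [w] in the opposite class. Each of the two cross blocks contributes
    at least 4 p q, its entries having squares at least 4. The total is 4 (p + q)^2. *)
Lemma gram_two_class_bound {n} (N : 'M[int]_n) (c : 'I_n -> bool) :
    N^T = N -> (forall u : 'rV_n, 0 <= (u *m N *m u^T) 0 0) ->
    (forall i, N i i = 4) ->
    (forall i j, c i = c j -> (4 %| N i j)%Z) ->
    (forall i j, c i != c j -> 2 <= `|N i j|) ->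
    (exists i j, c i != c j) ->
  4 * n%:Z ^+ 2 <= \sum_i \sum_j N i j ^+ 2.
Proof.
move=> N_sym N_psd Nii N4 N2 [i0 [j0 cij]].
wlog ci0 : c N4 N2 cij / c i0.
  move=> IH; case ci0: (c i0); first exact: (IH c).
  apply: (IH (fun i => ~~ c i)) => [i j /negb_inj|||]; first exact: N4.
  - by move=> i j; rewrite (inj_eq negb_inj); apply: N2.
  - by rewrite (inj_eq negb_inj).
  - by rewrite ci0.
have cj0 : ~~ c j0 by move: cij; rewrite ci0; case: (c j0).
pose A := [set i | c i].
have cross (B : {set 'I_n}) (i : 'I_n) : (forall j, j \in B -> c i != c j) ->
    4 * #|B|%:Z <= \sum_(j in B) N i j ^+ 2.
  move=> ciB; have -> : 4 * #|B|%:Z = \sum_(j in B) 4.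
    by rewrite sumr_const -[RHS]mulr_natr -natz.
  by apply: ler_sum => j /ciB /(N2 i j) N2ij; nia.
have cross2 (B C : {set 'I_n}) : (forall i j, i \in B -> j \in C -> c i != c j) ->
    4 * #|B|%:Z * #|C|%:Z <= \sum_(i in B) \sum_(j in C) N i j ^+ 2.
  move=> cBC; have -> : 4 * #|B|%:Z * #|C|%:Z = \sum_(i in B) 4 * #|C|%:Z.
    by rewrite sumr_const -[RHS]mulr_natr mulrAC -(natz #|B|).
  by apply: ler_sum => i iB; apply: cross => j; apply: cBC.
have in_class (B : {set 'I_n}) (w : 'I_n) :
    (forall i, i \in B -> c w != c i) ->
    4 * #|B|%:Z ^+ 2 <= \sum_(i in B) \sum_(j in B) N i j ^+ 2.
  move=> cwB; apply: (gram_class_bound N B w) => // [i iB|i j iB jB].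
    exact/N2/cwB.
  apply: N4; move: (cwB _ iB) (cwB _ jB).
  by case: (c w); case: (c i); case: (c j).
have cA i j : i \in A -> j \in ~: A -> c i != c j.
  by rewrite !inE => ->; case: (c j).
have hA : 4 * #|A|%:Z ^+ 2 <= \sum_(i in A) \sum_(j in A) N i j ^+ 2.
  by apply: (in_class A j0) => i iA; rewrite eq_sym cA // !inE.
have hAC : 4 * #|~: A|%:Z ^+ 2 <= \sum_(i in ~: A) \sum_(j in ~: A) N i j ^+ 2.
  by apply: (in_class _ i0) => i; apply: cA; rewrite inE.
have hX := cross2 _ _ cA.
have hY : 4 * #|~: A|%:Z * #|A|%:Z <= \sum_(i in ~: A) \sum_(j in A) N i j ^+ 2.
  by apply: cross2 => i j iA jA; rewrite eq_sym cA.
have split_sum (F : 'I_n -> int) :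
    \sum_i F i = \sum_(i in A) F i + \sum_(i in ~: A) F i.
  rewrite (bigID (mem A)) /=; congr (_ + _).
  by apply: eq_bigl => i; rewrite !inE.
rewrite split_sum; under eq_bigr do rewrite split_sum.
under [X in _ + X]eq_bigr do rewrite split_sum.
rewrite !big_split /=.
have n_split : n%:Z = #|A|%:Z + #|~: A|%:Z by rewrite -PoszD cardsC card_ord.
rewrite n_split; apply: le_trans (lerD (lerD hA hX) (lerD hY hAC)).
by move: (#|A|%:Z) (#|~: A|%:Z) => p q; lia.
Qed.

(** * Contradiction from the prescribed spectrum *)

Theorem theorem5p7 :
  ~ (exists (n : nat) (S : 'M[int]_n),
       is_seidel S /\
       char_poly S =
         ('X + 5%:P) ^+ 33 * ('X - 9%:P) ^+ 12 * ('X - 11%:P) ^+ 4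
           * ('X - 13%:P)).
Proof.
case=> n [S [seidelS char_S]].
pose s : seq int := nseq 33 (- 5) ++ nseq 12 9 ++ nseq 4 11 ++ [:: 13].
have {}char_S : char_poly S = \prod_(a <- s) ('X - a%:P).
  rewrite char_S /s !big_cat big_seq1 !big_nseq !iter_mulr_1 -2!mulrA.
  by rewrite polyCN opprK.
have n50 : n = 50%N.
  by have := size_prod_XsubC s id; rewrite /= -char_S size_char_poly => -[].
move: S seidelS char_S; rewrite {n}n50 => S seidelS char_S.
have [S_sym S0 S1] := seidelS.
(* [q] vanishes at -5 and 9, with q(11) = 32 and q(13) = 72. *)
pose q : {poly int} := ('X + 5%:P) * ('X - 9%:P).
pose N := horner_mx S q.
have NE i j : N i j = (S *m S) i j - 4 * S i j - 45 * (i == j)%:R.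
  rewrite /N /q rmorphM rmorphD rmorphB /= horner_mx_X !horner_mx_C -mulmxE.
  rewrite mulmxDl !mulmxBr mul_scalar_mx mul_mx_scalar -scalar_mxM.
  move: (S *m S) => T; rewrite !mxE.
  by case: (i == j); rewrite ?mulr1n ?mulr0n;
     move: (T i j : int) (S i j : int) => x y; lia.
have N_sym : N^T = N.
  apply/matrixP => i j; rewrite [LHS]mxE !NE eq_sym -[in S j i]S_sym [S^T _ _]mxE.
  congr (_ - _ - _); rewrite -[in RHS]S_sym -[X in _ *m X]S_sym.
  by rewrite -trmx_mul [RHS]mxE S_sym.
have N_psd (u : 'rV_50) : 0 <= (u *m N *m u^T) 0 0.
  apply: (horner_intmx_psd _ _ _ S_sym char_S) => a.
  by rewrite !mem_cat !mem_nseq mem_seq1 /= => /or4P[] /eqP ->; rewrite !hornerE.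
(* Since [N] is symmetric, the entrywise sum is the trace of f(S) q(S). Taking f = q gives 4 * 32^2
   + 72^2 = 9280, and f = X gives 4 * 11 * 32 + 13 * 72 = 2344. *)
have trE (f : {poly int}) : \sum_i \sum_j (horner_mx S f) i j * N i j =
    33 * (f * q).[-5] + 12 * (f * q).[9] + 4 * (f * q).[11] + (f * q).[13].
  transitivity (\tr (horner_mx S (f * q))).
    rewrite rmorphM; apply: eq_bigr => i _; rewrite mxE; apply: eq_bigr => j _.
    by rewrite -[in N i j]N_sym [N^T _ _]mxE.
  rewrite (mxtrace_horner_intmx _ _ _ S_sym char_S) /s !big_cat big_seq1 !big_nseq.
  by rewrite !iter_addr_0 -2!addrA !mulr_natl.
have trNN : \sum_i \sum_j N i j ^+ 2 = 9280.
  rewrite (trE q) !hornerE; vm_compute; reflexivity.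
have trSN : \sum_i \sum_j S i j * N i j = 2344.
  have := trE 'X; rewrite horner_mx_X => ->; rewrite !hornerE; vm_compute; reflexivity.
(* The diagonal of S^2 is 49, and 49 - 45 = 4. *)
have Nii i : N i i = 4.
  rewrite NE eqxx S0 mxE (bigD1 i) //= (eq_bigr (fun=> 1)) => [|k ki].
    by rewrite S0 sumr_const cardC1 card_ord.
  rewrite -[in S k i]S_sym mxE; rewrite eq_sym in ki.
  by case: (S1 _ _ ki) => ->.
pose r i := \sum_k S i k.
pose c i := (r i %% 4 == 1)%Z.
have r_odd i : (r i %% 2 = 1)%Z.
  by have := seidel_rowsum_odd S i seidelS; rewrite -/(r i); lia.
(* Modulo 4, -2 S_ij is 2 for either sign, and 2 - n = -48 vanishes. *)
have N_mod4 i j : i != j -> (4 %| N i j - (r i + r j + 2))%Z.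
  move=> ij; have := seidel_sqr_mod4 S i j seidelS ij.
  rewrite NE (negPf ij) -/(r i) -/(r j); move: ((S *m S) i j) => x.
  by case: (S1 _ _ ij) => ->; lia.
have N_same i j : c i = c j -> (4 %| N i j)%Z.
  case: (eqVneq i j) => [-> _|/N_mod4 + cij]; first by rewrite Nii.
  by have := (r_odd i, r_odd j, cij); rewrite /c => -[[]]; move: (N i j) => x; lia.
have N_diff i j : c i != c j -> 2 <= `|N i j|.
  move=> cij; have /N_mod4 : i != j by apply: contraNneq cij => ->.
  have := (r_odd i, r_odd j); rewrite /c in cij => -[]; move: (N i j) => x.
  by lia.
have [/existsP[i /existsP[j cij]]|c_const] := boolP [exists i, exists j, c i != c j].
  have := gram_two_class_bound N c N_sym N_psd Nii N_same N_diff.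
  by rewrite trNN => /(_ (ex_intro _ i (ex_intro _ j cij))).
have N4 i j : (4 %| N i j)%Z.
  apply: N_same; apply: (contraNeq _ c_const) => cij.
  by apply/existsP; exists i; apply/existsP; exists j.
(* Subtracting 16 = N_ii^2 makes both sides 0 on the diagonal; off it, S_ij N_ij <= |N_ij|. *)
have : \sum_i \sum_j (4 * (S i j * N i j)) <=
    \sum_i \sum_j (N i j ^+ 2 - 16 * (i == j)%:R).
  apply: ler_sum => i _; apply: ler_sum => j _.
  case: (eqVneq i j) => [<-|ij]; first by rewrite S0 Nii.
  move: (N i j) (dvd4_normr_le_sqr _ (N4 i j)) => x.
  by case: (S1 _ _ ij) => ->; lia.
have trI : \sum_(i < 50) \sum_(j < 50) 16 * (i == j)%:R = 800 :> int.
  rewrite (eq_bigr (fun=> 16)) ?sumr_const ?card_ord // => i _.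
  rewrite (bigD1 i) //= eqxx big1 // => j ji.
  by rewrite eq_sym (negPf ji).
under eq_bigr do rewrite -mulr_sumr.
under [X in _ <= X]eq_bigr do rewrite sumrB.
by rewrite -mulr_sumr sumrB trSN trNN trI.
Qed.
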